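(* Let $d,m\in\mathbb N$ and $\delta>0$. Let $G:(-\delta,\infty)^m\to\mathbb R$ be a $C^\infty$-function with $G(0)=0$, and let $G_0:\mathbb R^d\to\mathbb R^d$ be a homogeneous polynomial of degree $m_0\in\{0,1,2,\dots\}$. Let $p_j\in[1,\infty)$ and $s_j\in(0,\infty)$ for $j=1,\dots,m$ be given real numbers, and define $F:\mathbb R^d\to\mathbb R^d$ by $$F(x)=G(\|x\|_{p_1}^{s_1},\|x\|_{p_2}^{s_2},\dots,\|x\|_{p_m}^{s_m})\,G_0(x),\quad x\in\mathbb R^d.$$ Let $\bar s=\min\{s_j:1\le j\le m\}$ and assume $\bar s+m_0>1$. Then: (i) $F(0)=0$ and $F\in C(\mathbb R^d)\cap C^\infty(\mathbb R^d_* )$. (ii) $F\in\mathcal X^0(\mathbb R^d_* )$. (iii) If $p_1,\dots,p_m>1$, then $F\in C^1(\mathbb R^d)$, and, consequently, $F$ is locally Lipschitz in $\mathbb R^d$. (iv) If $p_1,p_2,\dots,p_m$ are even numbers, then $F\in\mathcal X$.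
   Context: $\mathbb R^d_*=(\mathbb R\setminus\{0\})^d$ and $\mathbb R^d_0=\mathbb R^d\setminus\{0\}$. $\|x\|_p=(\sum_{j=1}^d|x_j|^p)^{1/p}$ is the $\ell^p$-norm on $\mathbb R^d$; $|\cdot|$ is the Euclidean norm. A constant function, even zero, is considered a homogeneous polynomial of degree $0$. ''$f(x)=\mathcal O(h(x))$ as $x\to0$'' means there are $r,C>0$ with $|f(x)|\le Ch(x)$ for all $|x|<r$. $\mathcal H_\beta(\mathbb R^d)$ is the set of functions $G:\mathbb R^d\to\mathbb R^d$ with $G(tx)=t^\beta G(x)$ for all $x\in\mathbb R^d$, $t>0$. ''$G\in C^\infty(V)$'' means that $G$ restricted to the open set $V$ is infinitely differentiable. For an open set $V\subset\mathbb R^d$, $\mathcal X(V)$ (respectively $\mathcal X^0(V)$) is the set of locally Lipschitz (respectively continuous) functions $F:\mathbb R^d\to\mathbb R^d$ for which one of the following holds: (E1) there exist numbers $\beta_k\in(1,\infty)$, $k\in\mathbb N$, strictly increasing to infinity, and $F_k\in\mathcal H_{\beta_k}(\mathbb R^d)\cap C^\infty(V)$, $k\in\mathbb N$, such that for every $N\in\mathbb N$, $|F(x)-\sum_{k=1}^NF_k(x)|=\mathcal O(|x|^\beta)$ as $x\to0$ for some $\beta>\beta_N$; or (E2) there exist $N_*\in\mathbb N$, strictly increasing $\beta_1,\dots,\beta_{N_*}\in(1,\infty)$ and $F_k\in\mathcal H_{\beta_k}(\mathbb R^d)\cap C^\infty(V)$, $1\le k\le N_*$, such that $|F(x)-\sum_{k=1}^{N_*}F_k(x)|=\mathcal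 O(|x|^\beta)$ as $x\to0$ for all $\beta>\beta_{N_*}$. Finally $\mathcal X=\mathcal X(\mathbb R^d_0)$. *)

(* Defs.v *)
From HB Require Import structures.
From mathcomp Require Import all_boot all_order all_algebra.
From mathcomp Require Import all_classical all_reals all_analysis.
(* The notations of mpoly clash with those of the analysis library. *)
From mathcomp Require Import -(notations) mpoly.

Set Implicit Arguments.
Unset Strict Implicit.
Unset Printing Implicit Defensive.

Import Order.TTheory GRing.Theory Num.Theory.
Import numFieldNormedType.Exports.

Local Open Scope classical_set_scope.
Local Open Scope ring_scope.

(* The library's norm on 'rV[R]_d is the max norm, so the l^p norms (and the
   Euclidean one) are defined explicitly. The max norm is only used through its
   topology, its differentials and local Lipschitz continuity, which are the
   same for all norms on R^d. *)
Definition lpnorm (R : realType) (d : nat) (p : R) (x : 'rV[R]_d) : R :=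
  (\sum_(j < d) `|x ord0 j| `^ p) `^ p^-1.

Definition enorm (R : realType) (d : nat) (x : 'rV[R]_d) : R := lpnorm 2 x.

Definition Rd_star (R : realType) (d : nat) : set 'rV[R]_d :=
  [set x | forall j, x ord0 j != 0].

Definition Rd_nonzero (R : realType) (d : nat) : set 'rV[R]_d :=
  [set x | x != 0].

(* f is of class C^k on V, for V open: f is k times Frechet differentiable on V
   with continuous derivatives; the derivative of f, being a map into a
   finite-dimensional space of linear maps, is handled through its values
   'D_v f in each direction v. *)
Fixpoint class_C (R : realType) (n : nat) (W : normedModType R) (k : nat)
    (V : set 'rV[R]_n) (f : 'rV[R]_n -> W) : Prop :=
  match k with
  | 0%N => forall x, V x -> {for x, continuous f}
  | k'.+1 => (forall x, V x -> differentiable f x) /\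
             (forall v : 'rV[R]_n, class_C k' V (fun x => 'D_v f x))
  end.

Definition class_Coo (R : realType) (n : nat) (W : normedModType R)
    (V : set 'rV[R]_n) (f : 'rV[R]_n -> W) : Prop :=
  forall k, class_C k V f.

Definition locally_lipschitz (R : realType) (d : nat)
    (F : 'rV[R]_d -> 'rV[R]_d) : Prop :=
  forall x : 'rV[R]_d, exists2 U : set 'rV[R]_d, nbhs x U & [lipschitz F y | y in U].

Definition homogeneous_polynomial_map (R : realType) (d m0 : nat)
    (G : 'rV[R]_d -> 'rV[R]_d) : Prop :=
  exists P : 'I_d -> mpoly d R,
    (forall i, P i \is ishomog1 m0 mdeg) /\
    (forall x i, G x ord0 i = meval (fun j => x ord0 j) (P i)).

Definition pos_homogeneous (R : realType) (d : nat) (beta : R)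
    (G : 'rV[R]_d -> 'rV[R]_d) : Prop :=
  forall (x : 'rV[R]_d) (t : R), 0 < t -> G (t *: x) = t `^ beta *: G x.

Definition bigO_at0 (R : realType) (d : nat)
    (f : 'rV[R]_d -> 'rV[R]_d) (h : 'rV[R]_d -> R) : Prop :=
  exists r C : R, [/\ 0 < r, 0 < C &
    forall x, enorm x < r -> enorm (f x) <= C * h x].

(* Indices start at 0: beta k, Fk k and N stand for beta_(k+1), F_(k+1) and
   N+1 when counting from 1; likewise finite_expansion has N.+1 terms, so at
   least one. *)
Definition infinite_expansion (R : realType) (d : nat) (V : set 'rV[R]_d)
    (F : 'rV[R]_d -> 'rV[R]_d) : Prop :=
  exists (beta : nat -> R) (Fk : nat -> 'rV[R]_d -> 'rV[R]_d),
    [/\ forall k, 1 < beta k,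
        {homo beta : k l / (k < l)%N >-> k < l},
        beta k @[k --> \oo] --> +oo,
        forall k, pos_homogeneous (beta k) (Fk k) /\ class_Coo V (Fk k) &
        forall N : nat, exists2 b : R, beta N < b &
          bigO_at0 (fun x => F x - \sum_(k < N.+1) Fk k x)
                   (fun x => enorm x `^ b)].

Definition finite_expansion (R : realType) (d : nat) (V : set 'rV[R]_d)
    (F : 'rV[R]_d -> 'rV[R]_d) : Prop :=
  exists (N : nat) (beta : 'I_N.+1 -> R)
         (Fk : 'I_N.+1 -> 'rV[R]_d -> 'rV[R]_d),
    [/\ forall k, 1 < beta k,
        {homo beta : k l / (k < l)%N >-> k < l},
        forall k, pos_homogeneous (beta k) (Fk k) /\ class_Coo V (Fk k) &
        forall b : R, beta ord_max < b ->
          bigO_at0 (fun x => F x - \sum_(k < N.+1) Fk k x)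
                   (fun x => enorm x `^ b)].

Definition X_lip (R : realType) (d : nat) (V : set 'rV[R]_d)
    (F : 'rV[R]_d -> 'rV[R]_d) : Prop :=
  locally_lipschitz F /\ (infinite_expansion V F \/ finite_expansion V F).

Definition X_cont (R : realType) (d : nat) (V : set 'rV[R]_d)
    (F : 'rV[R]_d -> 'rV[R]_d) : Prop :=
  continuous F /\ (infinite_expansion V F \/ finite_expansion V F).

(* Main.v *)
Require Import Defs.
From HB Require Import structures.
From mathcomp Require Import all_boot all_order all_algebra.
From mathcomp Require Import all_classical all_reals all_analysis.
From mathcomp Require Import -(notations) mpoly.
From mathcomp Require Import ring.
Import Order.TTheory GRing.Theory Num.Theory.
Import numFieldNormedType.Exports.
Local Open Scope classical_set_scope.
Local Open Scope ring_scope.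

(** The function is a superposition [F x = G (Y x) *: G0 x], where the coordinate
    [Y_j = ||x||_(p_j)^(s_j)] is nonnegative, continuous and positively homogeneous of
    degree [s_j], and [G0] is smooth and homogeneous of degree [m0].

    Away from 0, the regularity of [F] is that of [Y], by the chain rule
    ([class_C_comp]). The norm is a positive power of the sum of the [|x_j|^p], so
    everything reduces to [|t|^p]: it is smooth for [t <> 0], a polynomial if [p] is
    even, and of class C^1 on the whole line if [p > 1].

    The asymptotic expansion comes from Taylor's formula for [G] at 0
    ([taylor_bound]). Substituting [Y] in a Taylor monomial and multiplying by [G0]
    gives a function homogeneous of degree [m0] plus a nonempty sum of the [s_j], thus
    of degree at least [sbar + m0 > 1]; the remainder of order [n] is
    [O(|x|^(n sbar + m0))]. These degrees form an unbounded set with finitely many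
    elements below any bound, which [discrete_enumeration] lists as an increasing
    sequence tending to infinity; the terms of a given degree, finitely many, are
    added up to form one term of the expansion. The resulting expansion is always
    an infinite one, some of its terms being possibly zero.

    At 0, the derivatives of a homogeneous function of degree [b] are homogeneous
    of degree [b - 1], and continuous homogeneous functions of degree [b] are
    [O(|x|^b)] by compactness of the sphere ([pos_homog_Opow]). If all [p_j > 1], then
    [F] is C^1 away from 0 and its derivatives are [O(|x|^(sbar + m0 - 1))], so they
    extend continuously by 0 ([superposition_C1]). The mean value theorem then gives
    the local Lipschitz property. *)

Set Implicit Arguments.
Unset Strict Implicit.
Unset Printing Implicit Defensive.
Arguments class_C : simpl never.

(** * Functions of class C^k *)

Lemma nbhs_norm_lt (R : realType) (V : normedModType R) (x : V) (r : R) :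
  0 < r -> nbhs x [set y | `|x - y| < r].
Proof. by move=> r0; apply/nbhs_normP; exists r. Qed.

Lemma continuous_normP (R : realType) (V W : normedModType R) (f : V -> W)
    (x : V) :
  {for x, continuous f} <->
  forall e : R, 0 < e -> exists2 r : R, 0 < r &
    forall y, `|x - y| < r -> `|f x - f y| <= e.
Proof.
split=> [cf e e0|H].
  move/cvgrPdist_le : cf => /(_ e e0) /nbhs_normP[r r0 Hr].
  by exists r => // y xy; exact: Hr.
apply/cvgrPdist_le => e e0; have [r r0 Hr] := H e e0.
near=> y; apply: Hr; near: y; exact: nbhs_norm_lt.
Unshelve. all: by end_near. Qed.

(** The epsilon-delta criterion used to recognise a given linear map as the
    differential, in particular at points where the chain rule says nothing. *)
Lemma is_diff_littleo (R : realType) (V W : normedModType R) (f : V -> W)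
    (df : {linear V -> W}) (x : V) :
  continuous df ->
  (forall e : R, 0 < e -> exists2 r : R, 0 < r &
     forall h, `|h| < r -> `|f (h + x) - f x - df h| <= e * `|h|) ->
  is_diff x f df.
Proof.
move=> cdf dfo.
have fo : f \o shift x = cst (f x) + df +o_ 0 id.
  apply/eqaddoP => e e0; have [r r0 Hr] := dfo e e0; near=> h.
  rewrite !fctE /= /shift /= opprD addrA; apply: Hr.
  by near: h; exact: nbhs0_lt.
have dE := diff_unique cdf fo.
apply: DiffDef (dE); apply/diff_locallyP; split; first by rewrite dE.
by rewrite dE.
Unshelve. all: by end_near. Qed.

Lemma near_eq_differentiable (R : realType) (V W : normedModType R)
    (f g : V -> W) (x : V) :
  (\near x, f x = g x) -> differentiable f x -> differentiable g x.
Proof.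
move=> fg dfx.
suff [] : is_diff x g ('d f x) by [].
apply: is_diff_littleo; first exact: diff_continuous.
move=> e e0.
have /eqaddoP/(_ e e0) /nbhs_normP[r r0 Hr] := diff_locally dfx.
move/nbhs_normP : (fg) => [q q0 Hq].
have fgx : f x = g x := nbhs_singleton fg.
exists (Num.min r q); first by rewrite lt_min r0.
move=> h; rewrite lt_min => /andP[hr hq].
have <- : f (h + x) = g (h + x).
  by apply: Hq; rewrite /= opprD addrCA subrr addr0 normrN.
by rewrite -fgx -addrA -opprD; apply: Hr; rewrite /= sub0r normrN.
Qed.

(** The unfolding equations of [class_C]. In degree 0 the point is typed in the
    normed module of row vectors, where the continuity lemmas of normed modules
    apply. *)
Lemma class_C0 (R : realType) n (W : normedModType R) V (f : 'rV[R]_n -> W) :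
  class_C 0 V f <->
  forall x, V x -> @continuous_at ('rV[R]_n : normedModType R) W x f.
Proof. by []. Qed.

Lemma class_CS (R : realType) n (W : normedModType R) V (f : 'rV[R]_n -> W) k :
  class_C k.+1 V f <->
  (forall x, V x -> differentiable f x) /\ forall v, class_C k V ('D_v f).
Proof. by []. Qed.

Lemma open_near_eq (R : realType) (E : normedModType R) (W : Type)
    (V : set E) (f g : E -> W) (x : E) :
  open V -> V x -> (forall x, V x -> f x = g x) -> \near x, f x = g x.
Proof.
move=> oV Vx fg; near=> y; apply: fg; near: y.
exact: open_nbhs_nbhs.
Unshelve. all: by end_near. Qed.

Lemma near_eq_continuous (R : realType) (E W : normedModType R)
    (f g : E -> W) (x : E) :
  (\near x, f x = g x) -> {for x, continuous f} -> {for x, continuous g}.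
Proof.
move=> fg cf; rewrite /prop_for /continuous_at -(nbhs_singleton fg).
by apply: cvg_trans cf; exact: near_eq_cvg.
Qed.

Lemma class_C_sub (R : realType) n (W : normedModType R) (U V : set 'rV[R]_n)
    (f : 'rV[R]_n -> W) k : U `<=` V -> class_C k V f -> class_C k U f.
Proof.
move=> UV; elim: k f => [|k IHk] f.
  by move=> /class_C0 cf; apply/class_C0 => x /UV; exact: cf.
move=> /class_CS[df cdf]; apply/class_CS; split=> [x /UV|v]; first exact: df.
exact: IHk.
Qed.

Section ClassC.
Variables (R : realType) (n : nat).
Implicit Types (V : set 'rV[R]_n).

(** Openness of [V] matters: derivatives at a point of [V] depend on the values
    of the function on a whole neighbourhood. *)
Lemma class_C_ext (W : normedModType R) V (f g : 'rV[R]_n -> W) k :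
  open V -> (forall x, V x -> f x = g x) -> class_C k V f -> class_C k V g.
Proof.
move=> oV; elim: k f g => [|k IHk] f g fg Cf.
  move/class_C0 in Cf; apply/class_C0 => x Vx.
  by apply: near_eq_continuous (Cf x Vx); exact: open_near_eq fg.
have fgx x : V x -> \near x, f x = g x by move=> Vx; exact: open_near_eq fg.
case: Cf => df Cdf.
apply/class_CS; split=> [x Vx|v].
  by apply: near_eq_differentiable (df x Vx); exact: fgx.
by apply: IHk (Cdf v) => x Vx; apply: near_eq_derive; exact: fgx.
Qed.

Lemma class_C_S (W : normedModType R) V (f : 'rV[R]_n -> W) k :
  class_C k.+1 V f -> class_C k V f.
Proof.
elim: k f => [|k IHk] f /class_CS[df Cdf].
  by move=> x Vx; apply: differentiable_continuous; exact: df.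
by split=> // v; apply: IHk; exact: Cdf.
Qed.

Lemma class_C_cst (W : normedModType R) V (c : W) k : class_C k V (cst c).
Proof.
elim: k c => [|k IHk] c; first by apply/class_C0 => x _; exact: cst_continuous.
apply/class_CS; split=> // v.
by rewrite (_ : (fun _ => _) = cst 0)//; apply/funext => x; rewrite derive_cst.
Qed.

Lemma class_CD (W : normedModType R) V (f g : 'rV[R]_n -> W) k :
  open V -> class_C k V f -> class_C k V g -> class_C k V (f + g).
Proof.
move=> oV; elim: k f g => [|k IHk] f g.
  move=> /class_C0 cf /class_C0 cg; apply/class_C0 => x Vx.
  by apply: continuousD; [exact: cf|exact: cg].
move=> /class_CS[df Cf] /class_CS[dg Cg]; apply/class_CS; split=> [x Vx|v].
  by apply: differentiableD; [exact: df|exact: dg].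
apply: (class_C_ext oV _ (IHk _ _ (Cf v) (Cg v))) => x Vx /=.
by rewrite deriveD//; apply: diff_derivable; [exact: df|exact: dg].
Qed.

Lemma class_CZl (W : normedModType R) V (f : 'rV[R]_n -> R) (w : W) k :
  open V -> class_C k V f -> class_C k V (fun x => f x *: w).
Proof.
move=> oV; elim: k f => [|k IHk] f.
  move=> /class_C0 cf; apply/class_C0 => x Vx.
  apply: (@continuous_comp _ _ _ f (fun r : R => r *: w)); first exact: cf.
  exact: scalel_continuous.
move=> /class_CS[df Cf]; apply/class_CS; split=> [x Vx|v].
  by apply: differentiableZl; exact: df.
apply: (class_C_ext oV _ (IHk _ (Cf v))) => x Vx /=.
rewrite !deriveE//; [|by apply: differentiableZl; exact: df|exact: df].
by rewrite diffZl//; exact: df.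
Qed.

Lemma class_CM V (f g : 'rV[R]_n -> R) k :
  open V -> class_C k V f -> class_C k V g -> class_C k V (f * g).
Proof.
move=> oV; elim: k f g => [|k IHk] f g.
  move=> /class_C0 cf /class_C0 cg; apply/class_C0 => x Vx.
  by apply: continuousM; [exact: cf|exact: cg].
move=> Cf Cg; have /class_CS[df Cdf] := Cf; have /class_CS[dg Cdg] := Cg.
apply/class_CS; split=> [x Vx|v].
  by apply: differentiableM; [exact: df|exact: dg].
have /(class_C_ext oV) : class_C k V (f * (fun x => 'D_v g x) + g * (fun x => 'D_v f x)).
  apply: class_CD => //; apply: IHk => //; exact: class_C_S.
apply => x Vx /=.
by rewrite deriveM//; apply: diff_derivable; [exact: df|exact: dg].
Qed.

Lemma class_C_sum (W : normedModType R) V (I : Type) (r : seq I) (P : pred I)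
    (f : I -> 'rV[R]_n -> W) k : open V ->
  (forall i, P i -> class_C k V (f i)) ->
  class_C k V (fun x => \sum_(i <- r | P i) f i x).
Proof.
move=> oV Cf; rewrite (_ : (fun _ => _) = \sum_(i <- r | P i) f i); last first.
  by apply/funext => x; rewrite fct_sumE.
apply: (big_ind (class_C k V)) => //; first exact: class_C_cst.
by move=> ? ? ? ?; exact: class_CD.
Qed.

Lemma class_C_prod V (I : Type) (r : seq I) (P : pred I)
    (f : I -> 'rV[R]_n -> R) k : open V ->
  (forall i, P i -> class_C k V (f i)) ->
  class_C k V (fun x => \prod_(i <- r | P i) f i x).
Proof.
move=> oV Cf; elim: r => [|i r IHr].
  by rewrite (_ : (fun _ => _) = cst 1); [exact: class_C_cst|
     apply/funext => x; rewrite big_nil].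
case Pi: (P i); last first.
  by rewrite (_ : (fun _ => _) = (fun x => \prod_(i <- r | P i) f i x))//;
     apply/funext => x; rewrite big_cons Pi.
rewrite (_ : (fun _ => _) = f i * (fun x => \prod_(i <- r | P i) f i x)).
  by apply: class_CM => //; exact: Cf.
by apply/funext => x; rewrite big_cons Pi.
Qed.

Lemma class_CX V (f : 'rV[R]_n -> R) k a : open V ->
  class_C k V f -> class_C k V (fun x => f x ^+ a).
Proof.
move=> oV Cf; rewrite (_ : (fun _ => _) = fun x => \prod_(i < a) f x).
  exact: class_C_prod.
by apply/funext => x; rewrite prodr_const card_ord.
Qed.

Lemma class_C_coord V j k :
  class_C k V (fun x : 'rV[R]_n => x ord0 j : R).
Proof.
case: k => [|k]; first by move=> x _; exact: coord_continuous.
apply/class_CS; split=> [x _|v]; first exact: differentiable_coord.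
rewrite (_ : (fun _ => _) = cst (v ord0 j)); first exact: class_C_cst.
apply/funext => x /=.
have := @derive_mx R 'rV[R]_n 1 n id x v (@derivable_id _ _ _ _).
by rewrite derive_id => /matrixP/(_ ord0 j); rewrite mxE => ->.
Qed.

Lemma class_C_row V m (f : 'rV[R]_n -> 'rV[R]_m) k : open V ->
  (forall j, class_C k V (fun x => f x ord0 j : R)) -> class_C k V f.
Proof.
move=> oV Cf.
rewrite (_ : f = fun x => \sum_j (f x ord0 j *: delta_mx ord0 j)); last first.
  by apply/funext => x; rewrite -row_sum_delta.
by apply: class_C_sum => // j _; exact: class_CZl.
Qed.

(** Induction on [k] for all exponents at once, since differentiating lowers the
    exponent. Positivity of [f] keeps away from the singularity of the power. *)
Lemma class_C_powR V (f : 'rV[R]_n -> R) (a : R) k : open V ->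
  (forall x, V x -> 0 < f x) -> class_C k V f ->
  class_C k V (fun x => f x `^ a).
Proof.
move=> oV f0; elim: k a => [|k IHk] a Cf.
  move=> x Vx; have fx0 := f0 x Vx.
  apply: (@continuous_comp _ _ _ f (fun r : R => r `^ a)); first exact: Cf.
  apply/differentiable_continuous/derivable1_diffP.
  by apply: derivable_powR; rewrite in_itv/= fx0.
have /class_CS[df Cdf] := Cf; apply/class_CS; split=> [x Vx|v].
  apply: (@differentiable_comp _ _ _ _ f (fun r : R => r `^ a)); first exact: df.
  apply/derivable1_diffP.
  by apply: derivable_powR; rewrite in_itv/= f0.
have /(class_C_ext oV) : class_C k V
    (a \*: (fun x => f x `^ (a - 1)) * (fun x => 'D_v f x)).
  apply: class_CM => //.
  rewrite (_ : _ \*: _ = fun x => f x `^ (a - 1) *: a).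
    by apply: class_CZl => //; apply: IHk; exact: class_C_S.
  by apply/funext => x; rewrite /GRing.scale /= mulrC.
apply => x Vx /=.
have dpow : derivable (fun r : R => r `^ a) (f x) 1.
  by apply: derivable_powR; rewrite in_itv/= f0.
rewrite [RHS]deriveE; last first.
  apply: (@differentiable_comp _ _ _ _ f (fun r : R => r `^ a)); first exact: df.
  exact/derivable1_diffP.
rewrite (@diff_comp _ _ _ _ f (fun r : R => r `^ a)); [|exact: df|exact/derivable1_diffP].
rewrite /= diff1E; last exact/derivable1_diffP.
rewrite powR_derive1 ?in_itv/= ?f0 //.
rewrite -deriveE; last exact: df.
by rewrite [RHS]mulrC.
Qed.

Lemma derive_comp_row m (Y : 'rV[R]_n -> 'rV[R]_m) (G : 'rV[R]_m -> R) x v :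
  differentiable Y x -> differentiable G (Y x) ->
  'D_v (G \o Y) x =
  \sum_j 'D_v (fun x => Y x ord0 j : R) x * 'D_(delta_mx ord0 j) G (Y x).
Proof.
move=> dY dG.
rewrite deriveE; last exact: differentiable_comp.
rewrite diff_comp//=.
rewrite [X in 'd G _ X]row_sum_delta linear_sum; apply: eq_bigr => j _.
have -> : 'D_v (fun x => Y x ord0 j : R) x = 'd Y x v ord0 j.
  by rewrite -(deriveE _ dY) derive_mx ?mxE//; exact: diff_derivable.
by rewrite deriveE// linearZ.
Qed.

(** By the chain rule [derive_comp_row], the derivatives of [G \o Y] are sums of
    products of derivatives of [Y] and of composites of partial derivatives of [G]
    with [Y], to which the induction hypothesis applies. *)
Lemma class_C_comp m V (U : set 'rV[R]_m) (Y : 'rV[R]_n -> 'rV[R]_m)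
    (G : 'rV[R]_m -> R) k : open V ->
  (forall x, V x -> U (Y x)) ->
  (forall j, class_C k V (fun x => Y x ord0 j : R)) ->
  class_C k U G -> class_C k V (G \o Y).
Proof.
move=> oV VU; elim: k G => [|k IHk] G CY CG.
  move=> x Vx; apply: continuous_comp; last exact/CG/VU.
  by have := class_C_row oV CY; apply.
have /class_CS[dY _] := class_C_row oV CY.
have /class_CS[dG CdG] := CG.
apply/class_CS; split=> [x Vx|v].
  by apply: differentiable_comp; [exact: dY|exact/dG/VU].
have /(class_C_ext oV) : class_C k V (fun x => \sum_j
    ((fun x => 'D_v (fun x => Y x ord0 j : R) x) *
     (('D_(delta_mx ord0 j) G : 'rV[R]_m -> R) \o Y)) x).
  apply: class_C_sum => // j _; apply: class_CM => //.
    by have /class_CS[_] := CY j; apply.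
  by apply: IHk => // i; exact: class_C_S.
apply => x Vx /=; rewrite derive_comp_row//; [exact: dY|exact/dG/VU].
Qed.

End ClassC.

(** * Taylor's formula at the origin *)

Lemma derive_coord (R : realType) n (f : 'rV[R]_n -> R) x v :
  differentiable f x ->
  'D_v f x = \sum_j v ord0 j * 'D_(delta_mx ord0 j) f x.
Proof.
move=> df; rewrite deriveE// {1}[v]row_sum_delta linear_sum.
by apply: eq_bigr => j _; rewrite linearZ deriveE.
Qed.

Lemma is_derive_line (R : realType) (V W : normedModType R) (f : V -> W)
    (x v : V) (t : R) : derivable f (t *: v + x) v ->
  is_derive t 1 (fun u => f (u *: v + x)) ('D_v f (t *: v + x)).
Proof.
have E : (fun h : R => h^-1 *: (((fun u => f (u *: v + x)) \o shift t) (h *: 1)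
                        - f (t *: v + x)))
  = (fun h : R => h^-1 *: ((f \o shift (t *: v + x)) (h *: v) - f (t *: v + x))).
  apply/funext => h /=; rewrite scalerDl addrA; congr (_ *: (f (_ *: _ + _ + _) - _)).
  by rewrite /GRing.scale /= mulr1.
move=> df; apply: DeriveDef; first by rewrite /derivable E.
by rewrite /derive E.
Qed.

Section Taylor.
Variables (R : realType) (m : nat).
Implicit Types (G : 'rV[R]_m -> R) (w : seq 'I_m) (y : 'rV[R]_m).

(** Taylor terms are indexed by words rather than multi-indices: the term of
    degree [k] is then a sum over words of length [k] divided by [k`!], and
    splitting off the first letter gives the recursion [taylor_partS]. *)
Fixpoint words (k : nat) : seq (seq 'I_m) :=
  if k is k'.+1 then [seq j :: w | j <- enum 'I_m, w <- words k'] else [:: [::]].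

Fixpoint taylor_coef w G : R :=
  if w is j :: w' then taylor_coef w' ('D_(delta_mx ord0 j) G) else G 0.

Definition monom w y : R := \prod_(j <- w) y ord0 j.

Definition taylor_part k G y : R :=
  \sum_(w <- words k) taylor_coef w G * monom w y.

Lemma mem_words w : w \in words (size w).
Proof.
elim: w => [|j w IHw]; first by rewrite inE.
by apply/allpairsP; exists (j, w); rewrite mem_enum.
Qed.

Lemma size_words k w : w \in words k -> size w = k.
Proof.
elim: k w => [|k IHk] w; first by rewrite inE => /eqP ->.
by move=> /allpairsP[[j u] [_ /IHk /= <- ->]].
Qed.

Lemma taylor_part0 G y : taylor_part 0 G y = G 0.
Proof. by rewrite /taylor_part big_seq1 /monom big_nil mulr1. Qed.

Lemma taylor_partS k G y :
  taylor_part k.+1 G y =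
  \sum_j y ord0 j * taylor_part k ('D_(delta_mx ord0 j) G) y.
Proof.
rewrite /taylor_part [words k.+1]/= big_allpairs_dep big_enum /=.
apply: eq_bigr => j _; rewrite mulr_sumr; apply: eq_bigr => w _.
by rewrite /monom big_cons mulrCA.
Qed.

Lemma taylor_partZ k G y (t : R) :
  taylor_part k G (t *: y) = t ^+ k * taylor_part k G y.
Proof.
elim: k G => [|k IHk] G; first by rewrite !taylor_part0 expr0 mul1r.
rewrite !taylor_partS mulr_sumr; apply: eq_bigr => j _.
by rewrite IHk mxE exprS; ring.
Qed.

(** Induction on [n]: along the segment from 0 to [y], the function
    [G (t y)] minus its Taylor polynomial vanishes at [t = 0], and its derivative is
    the combination, with coefficients the coordinates of [y], of the remainders
    of order [n] of the partial derivatives of [G]. The mean value theorem on [[0, 1]]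
    then gains one power of [`|y|]. *)
Lemma taylor_bound n (r : R) G : 0 < r ->
  class_C n [set y | `|y| < r] G ->
  exists C r' : R, [/\ 0 < r', r' <= r & forall y, `|y| < r' ->
    `|G y - \sum_(k < n) taylor_part k G y / k`!%:R| <= C * `|y| ^+ n].
Proof.
move=> r0; elim: n G => [|n IHn] G.
  move=> /class_C0 /(_ 0); rewrite /= normr0 => /(_ r0) cG.
  have [e /= e0 He] : exists2 e : R, 0 < e & forall y, `|y| < e -> `|G 0 - G y| <= 1.
    move/continuous_normP : cG => /(_ 1 ltr01)[e e0 He].
    by exists e => // y ye; apply: He; rewrite /= sub0r normrN.
  exists (`|G 0| + 1), (Num.min e r); split.
  - by rewrite lt_min e0 r0.
  - by rewrite ge_min lexx orbT.
  move=> y; rewrite lt_min => /andP[ye _].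
  rewrite big_ord0 subr0 expr0 mulr1.
  have := He y ye; rewrite distrC => H.
  by rewrite -[G y](subrK (G 0)) addrC (le_trans (ler_normD _ _))// lerD2l.
move=> /class_CS[dG CdG].
have /choice[C /choice[r' H]] := fun j => IHn _ (CdG (delta_mx ord0 j)).
pose rm := \big[Num.min/r]_j r' j.
have rm0 : 0 < rm.
  by apply: lt_bigmin => // j _; have [] := H j.
have rmr : rm <= r by exact: bigmin_le_id.
exists (\sum_j `|C j|), rm; split => // y yrm.
(* By homogeneity, the Taylor polynomial at t y is a polynomial in t. *)
pose p : {poly R} := \poly_(k < n.+1) (taylor_part k G y / k`!%:R).
pose h : R -> R := (fun t : R => G (t *: y + 0)) - horner p.
pose dh t : R := 'D_y G (t *: y + 0) - p^`().[t].
have inr (t : R) : t \in `[0, 1]%R -> `|t *: y + 0| < rm.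
  rewrite in_itv/= => /andP[t0 t1]; rewrite addr0 normrZ ger0_norm//.
  by rewrite (le_lt_trans _ yrm)// ler_piMl.
have dht (t : R) : t \in `[0, 1]%R -> is_derive t 1 h (dh t).
  move=> t01; apply: is_deriveB.
  apply: is_derive_line; apply: diff_derivable; apply: dG => /=.
  by rewrite (lt_le_trans (inr t t01)).
have dho (t : R) : t \in `]0, 1[%R -> is_derive t 1 h (dh t).
  by move=> t01; apply: dht; exact: subset_itv_oo_cc t01.
have ch : {within `[(0 : R), 1], continuous h}.
  apply: derivable_within_continuous => t t01.
  exact: (@ex_derive _ _ _ _ _ _ _ (dht t t01)).
have [c c01] := @MVT R h dh 0 1 ltr01 dho ch.
have -> : h 0 = 0.
  rewrite /h /= !fctE scale0r addr0 horner_poly big_ord_recl /= taylor_part0.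
  rewrite expr0 mulr1 divr1 big1 ?addr0 ?subrr// => i _.
  by rewrite expr0n mulr0.
have -> : h 1 = G y - \sum_(k < n.+1) taylor_part k G y / k`!%:R.
  rewrite /h /= !fctE scale1r addr0 horner_poly; congr (_ - _).
  by apply: eq_bigr => i _; rewrite expr1n mulr1.
rewrite !subr0 mulr1 => ->.
have c01' : c \in `[0, 1]%R by apply: subset_itv_oo_cc c01.
have -> : dh c = \sum_j y ord0 j * ('D_(delta_mx ord0 j) G (c *: y)
  - \sum_(k < n) taylor_part k ('D_(delta_mx ord0 j) G) (c *: y) / k`!%:R).
  rewrite /dh derive_coord; last first.
    by apply: dG; rewrite /= (lt_le_trans (inr c c01')).
  have -> : p^`() = \poly_(k < n) (taylor_part k.+1 G y / k`!%:R).
    apply/polyP => k; rewrite coef_deriv !coef_poly ltnS.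
    case: ifP => _; last by rewrite mul0rn.
    rewrite -[LHS]mulr_natr -mulrA; congr (_ * _).
    by rewrite factS natrM invfM mulrAC mulVf ?pnatr_eq0// mul1r.
  rewrite horner_poly addr0.
  under [RHS]eq_bigr do rewrite mulrBr.
  rewrite sumrB; congr (_ - _).
  under [RHS]eq_bigr do rewrite mulr_sumr.
  rewrite exchange_big /=; apply: eq_bigr => k _.
  rewrite taylor_partS !mulr_suml; apply: eq_bigr => j _.
  by rewrite taylor_partZ; ring.
rewrite (le_trans (ler_norm_sum _ _ _))// exprS mulr_suml ler_sum// => j _.
have [rj0 rjr Hj] := H j.
have cy : `|c *: y| < r' j.
  by have := inr c c01'; rewrite addr0 => /lt_le_trans -> //; exact: bigmin_le.
rewrite normrM mulrCA ler_pM//.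
  by rewrite {2}/Num.norm /= mx_normrE; exact: (le_bigmax _ _ (ord0, j)).
rewrite (le_trans (Hj _ cy))//.
rewrite (le_trans (ler_norm _))// normrM ler_wpM2l// normrX normr_id.
rewrite lerXn2r ?nnegrE// normrZ ler_piMl//.
by move: c01'; rewrite in_itv/= => /andP[c0 c1]; rewrite ger0_norm.
Qed.

End Taylor.

(** * Increasing enumeration of discrete sets of reals *)

Section Enumeration.
Variables (R : realType) (D : set R) (b0 : R).
Hypothesis Db0 : D b0.
Hypothesis D_lb : forall v, D v -> b0 <= v.
Hypothesis D_unbounded : forall v, D v -> exists2 u, D u & v < u.
Hypothesis D_locfin : forall B : R, exists l : seq R,
  forall v, D v -> v <= B -> v \in l.

Lemma seq_has_min (P : set R) (l : seq R) v : P v -> v \in l ->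
  exists2 u, P u & forall w, P w -> w \in l -> u <= w.
Proof.
elim: l v => [//|a l IHl] v Pv.
have [[u Pu lu]|none] := pselect (exists2 u, P u & u \in l).
  move=> _; have [u' Pu' u'min] := IHl u Pu lu.
  have [Pa|nPa] := pselect (P a); last first.
    exists u' => // w Pw; rewrite inE => /orP[/eqP wa|]; last exact: u'min.
    by rewrite -wa in nPa.
  have [au'|u'a] := leP a u'.
    exists a => // w Pw; rewrite inE => /orP[/eqP ->//|wl].
    by rewrite (le_trans au')// u'min.
  exists u' => // w Pw; rewrite inE => /orP[/eqP ->|wl]; first exact: ltW.
  exact: u'min.
rewrite inE => /orP[/eqP va|vl]; last by exfalso; apply: none; exists v.
exists v => // w Pw; rewrite inE => /orP[/eqP ->|wl]; first by rewrite va.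
by exfalso; apply: none; exists w.
Qed.

Lemma next_element v : D v ->
  exists u, [/\ D u, v < u & forall w, D w -> v < w -> u <= w].
Proof.
move=> /D_unbounded[u Du vu].
have [l Hl] := D_locfin u.
have [u' [Du' vu'] u'min] := @seq_has_min (fun w => D w /\ v < w) l u
  (conj Du vu) (Hl u Du (lexx u)).
exists u'; split => // w Dw vw.
have [wu|uw] := leP w u; first by apply: u'min => //; exact: Hl.
by rewrite (le_trans _ (ltW uw))// u'min// Hl.
Qed.

(** Start at the least element and iterate the successor [next_element]. The
    sequence is injective, so it cannot stay in the finite part of [D] below a given
    bound; hence it tends to infinity, and every element of [D] is reached, since
    no element lies strictly between consecutive terms. *)
Lemma discrete_enumeration : exists beta : nat -> R,
  [/\ beta 0%N = b0, forall k, D (beta k),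
      {homo beta : k l / (k < l)%N >-> k < l},
      forall v, D v -> exists k, v = beta k &
      beta k @[k --> \oo] --> +oo].
Proof.
have /choice[next Hn] : forall v : {v | D v}, exists u : {v | D v},
    sval v < sval u /\ forall w, D w -> sval v < w -> sval u <= w.
  move=> [v Dv]; have [u [Du vu uw]] := next_element Dv.
  by exists (exist _ u Du).
pose b k := iter k next (exist _ b0 Db0).
pose beta k := sval (b k).
have Dbeta k : D (beta k) by exact: svalP.
have beta_lt : {homo beta : k l / (k < l)%N >-> k < l}.
  apply: homo_ltn; first exact: lt_trans.
  by move=> k; exact: (Hn (b k)).1.
have beta_next k w : D w -> beta k < w -> beta k.+1 <= w.
  exact: (Hn (b k)).2.
have beta_inj : injective beta.
  move=> k l kl; case: (ltngtP k l) => // /beta_lt; rewrite kl ltxx//.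
have beta_large B : exists k, B < beta k.
  have [l Hl] := D_locfin B.
  apply/not_existsP => nB.
  have sub : {subset [seq beta k | k <- iota 0 (size l).+1] <= l}.
    move=> _ /mapP[k _ ->]; apply: Hl => //.
    by rewrite leNgt; apply/negP => /nB.
  have := uniq_leq_size _ sub; rewrite map_inj_uniq// iota_uniq => /(_ isT).
  by rewrite size_map size_iota ltnn.
exists beta; split => //.
  move=> v Dv; have [k] := beta_large v.
  elim: k => [|k IHk]; first by move=> /lt_le_trans/(_ (D_lb Dv)); rewrite ltxx.
  move=> vk; have [/IHk//|] := ltP v (beta k).
  rewrite le_eqVlt => /orP[/eqP <-|/(beta_next _ _ Dv)]; first by exists k.
  by rewrite leNgt vk.
apply/cvgryPge => B; have [k Bk] := beta_large B.
near=> l; apply: (le_trans (ltW Bk)).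
have : (k <= l)%N by near: l; exact: nbhs_infty_ge.
by rewrite leq_eqVlt => /orP[/eqP ->//|/beta_lt/ltW].
Unshelve. all: by end_near. Qed.

End Enumeration.

(** * Growth at the origin and homogeneous functions *)

Section BigO.
Variables (R : realType) (d : nat).
Implicit Types (f g : 'rV[R]_d -> R) (b c : R).

(** [f x = O(|x|^b)] as [x] tends to 0 with [x] different from 0. The puncture
    makes negative and zero exponents meaningful, as needed for derivatives. *)
Definition Opow b f := exists C r : R, [/\ 0 <= C, 0 < r &
  forall x, x != 0 -> `|x| < r -> `|f x| <= C * `|x| `^ b].

Lemma Opow_le b c f : b <= c -> Opow c f -> Opow b f.
Proof.
move=> bc [C [r [C0 r0 H]]]; exists C, (Num.min r 1); split => //.
  by rewrite lt_min r0 ltr01.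
move=> x x0; rewrite lt_min => /andP[xr x1].
rewrite (le_trans (H _ x0 xr))// ler_wpM2l// ger_powR//.
by rewrite normr_gt0 x0 ltW.
Qed.

Lemma Opow_ext b f g : (forall x, x != 0 -> f x = g x) -> Opow b f -> Opow b g.
Proof.
move=> fg [C [r [C0 r0 H]]]; exists C, r; split => // x x0 xr.
by rewrite -fg// H.
Qed.

Lemma Opow0 b : Opow b (fun=> 0).
Proof.
by exists 0, 1; split => // x _ _; rewrite normr0 mul0r.
Qed.

Lemma Opow_cst (a : R) : Opow 0 (fun=> a).
Proof. by exists `|a|, 1; split => // x _ _; rewrite powRr0 mulr1. Qed.

Lemma OpowD b f g : Opow b f -> Opow b g -> Opow b (fun x => f x + g x).
Proof.
move=> [C [r [C0 r0 Hf]]] [C' [r' [C'0 r'0 Hg]]].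
exists (C + C'), (Num.min r r'); split; first exact: addr_ge0.
  by rewrite lt_min r0.
move=> x x0; rewrite lt_min => /andP[xr xr'].
by rewrite (le_trans (ler_normD _ _))// mulrDl lerD ?Hf ?Hg.
Qed.

Lemma OpowM b c f g : Opow b f -> Opow c g -> Opow (b + c) (fun x => f x * g x).
Proof.
move=> [C [r [C0 r0 Hf]]] [C' [r' [C'0 r'0 Hg]]].
exists (C * C'), (Num.min r r'); split; first exact: mulr_ge0.
  by rewrite lt_min r0.
move=> x x0; rewrite lt_min => /andP[xr xr'].
rewrite normrM powRD; last by rewrite normr_eq0 x0 implybT.
by rewrite mulrACA ler_pM ?Hf ?Hg.
Qed.

Lemma Opow_sum b (I : Type) (s : seq I) (P : pred I) (f : I -> 'rV[R]_d -> R) :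
  (forall i, P i -> Opow b (f i)) ->
  Opow b (fun x => \sum_(i <- s | P i) f i x).
Proof.
move=> Hf; elim: s => [|i s IHs].
  by apply: Opow_ext (Opow0 b) => x _; rewrite big_nil.
case Pi : (P i); last by apply: Opow_ext IHs => x _; rewrite big_cons Pi.
by apply: Opow_ext (OpowD (Hf i Pi) IHs) => x _; rewrite big_cons Pi.
Qed.

Lemma Opow_prod (I : Type) (s : seq I) (b : I -> R) (f : I -> 'rV[R]_d -> R) :
  (forall i, Opow (b i) (f i)) ->
  Opow (\sum_(i <- s) b i) (fun x => \prod_(i <- s) f i x).
Proof.
move=> Hf; elim: s => [|i s IHs].
  by rewrite big_nil; apply: Opow_ext (Opow_cst 1) => x _; rewrite big_nil.
by rewrite big_cons; apply: Opow_ext (OpowM (Hf i) IHs) => x _; rewrite big_cons.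
Qed.

Lemma Opow_row m b (Y : 'rV[R]_d -> 'rV[R]_m) :
  (forall j, Opow b (fun x => Y x ord0 j)) ->
  exists C r : R, [/\ 0 <= C, 0 < r &
  forall x, x != 0 -> `|x| < r -> `|Y x| <= C * `|x| `^ b].
Proof.
move=> HY.
have [C [r [C0 r0 H]]] : Opow b (fun x => \sum_j `|Y x ord0 j|).
  apply: Opow_sum => j _; have [C [r [C0 r0 H]]] := HY j.
  by exists C, r; split => // x x0 xr; rewrite normr_id H.
exists C, r; split => // x x0 xr; apply: le_trans (H x x0 xr).
rewrite {1}/Num.norm /= mx_normrE ger0_norm ?sumr_ge0//.
apply: bigmax_le; first exact: sumr_ge0.
move=> [i j] _ /=; rewrite (bigD1 j)//= ord1 lerDl sumr_ge0//.
Qed.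

(** If [G] vanishes to order [n] at 0 and [Y] is [O(|x|^b)], then [b > 0] forces
    [Y x] into the ball where the bound on [G] holds. *)
Lemma Opow_comp m b n (Y : 'rV[R]_d -> 'rV[R]_m) (G : 'rV[R]_m -> R) (C r : R) :
  0 < b -> 0 < r -> (forall y, `|y| < r -> `|G y| <= C * `|y| ^+ n) ->
  (forall j, Opow b (fun x => Y x ord0 j)) ->
  Opow (b * n%:R) (G \o Y).
Proof.
move=> b0 r0 HG /Opow_row[K [q [K0 q0 HY]]].
exists (`|C| * K ^+ n), (Num.min q ((r / (K + 1)) `^ b^-1)); split.
- by rewrite mulr_ge0// exprn_ge0.
- by rewrite lt_min q0 powR_gt0// divr_gt0// ltr_wpDl.
move=> x x0; rewrite lt_min => /andP[xq xr].
have Yx := HY x x0 xq.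
have Yr : `|Y x| < r.
  apply: le_lt_trans Yx _.
  have K10 : 0 < K + 1 by rewrite ltr_wpDl.
  apply: (@le_lt_trans _ _ ((K + 1) * `|x| `^ b)).
    by rewrite ler_wpM2r ?powR_ge0// lerDl.
  rewrite mulrC -ltr_pdivlMr//.
  have := gt0_ltr_powR b0 _ _ xr; rewrite -powRrM mulVf ?gt_eqF// powRr1; last first.
    by rewrite divr_ge0// ltW.
  by apply; rewrite ?nnegrE ?powR_ge0.
rewrite /= (le_trans (HG _ Yr))//.
rewrite (le_trans (ler_norm _))// normrM -mulrA ler_wpM2l//.
rewrite normrX normr_id powRrM powR_mulrn ?powR_ge0// -exprMn.
by rewrite lerXn2r// ?nnegrE// mulr_ge0// powR_ge0.
Qed.

Definition pos_homog b f := forall x (t : R), 0 < t -> f (t *: x) = t `^ b * f x.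

Lemma pos_homog0 b f : 0 < b -> pos_homog b f -> f 0 = 0.
Proof.
move=> b0 hf; have := hf 0 2 (ltr0n _ _); rewrite scaler0 => /eqP.
rewrite -subr_eq0 -{1}[f 0]mul1r -mulrBl mulf_eq0 subr_eq0 => /orP[|/eqP//].
by rewrite eq_sym powR_eq1 (gt_eqF b0) orbF gt_eqF ?ltr1n// ltNge ler0n.
Qed.

(** Differentiate the identity [f (t x) = t^b f x] in [x] and divide by [t]. *)
Lemma derive_pos_homog b f x v (t : R) : pos_homog b f -> 0 < t ->
  differentiable f x -> differentiable f (t *: x) ->
  'D_v f (t *: x) = t `^ (b - 1) * 'D_v f x.
Proof.
move=> hf t0 dx dtx.
have tn0 : t != 0 by rewrite gt_eqF.
have E : f \o ( *:%R t) = t `^ b \*: f by apply/funext => y; exact: hf.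
have : 'D_v (f \o ( *:%R t)) x = 'D_v (t `^ b \*: f) x by rewrite E.
rewrite deriveZ; last exact: diff_derivable.
rewrite deriveE; last by apply: differentiable_comp.
rewrite diff_comp//= diff_val linearZ -deriveE// => /(congr1 ( *%R t^-1)).
rewrite /GRing.scale /= mulrA mulVf// mul1r => ->.
rewrite mulrA; congr (_ * _).
by rewrite powRB ?(negbTE tn0) ?implybT// powRr1 ?ltW// mulrC.
Qed.

(** A continuous function is bounded on the unit sphere, which is compact, and
    homogeneity carries the bound to every other sphere. *)
Lemma pos_homog_Opow b f :
  (forall x (t : R), 0 < t -> x != 0 -> f (t *: x) = t `^ b * f x) ->
  class_C 0 (@Rd_nonzero R d) f -> Opow b f.
Proof.
move=> hf /class_C0 cf.
pose S : set 'rV[R]_d := [set x | `|x| = 1].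
have cS : compact S.
  apply: bounded_closed_compact.
    exists 1; split => // M M1 x /= ->; exact: ltW.
  rewrite (_ : S = (fun x : 'rV[R]_d => `|x|) @^-1` [set 1])//.
  by apply: closed_comp => [x _|]; [exact: norm_continuous|exact: closed_eq].
have : compact (f @` S).
  apply: continuous_compact => //; apply: continuous_in_subspaceT => x.
  rewrite inE /S /= => x1; apply: cf.
  by rewrite /Rd_nonzero/= -normr_eq0 x1 oner_neq0.
move=> /compact_bounded[M [_ HM]].
have M1 : M < `|M| + 1 by rewrite (le_lt_trans (ler_norm M))// ltrDl.
exists (`|M| + 1), 1; split => // x x0 _.
have nx0 : 0 < `|x| by rewrite normr_gt0.
have nx0' : `|x| != 0 by rewrite gt_eqF.
rewrite -{1}[x](scalerKV nx0').
rewrite hf//; last by rewrite scaler_eq0 invr_eq0 (negbTE nx0').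
rewrite normrM ger0_norm ?powR_ge0// mulrC ler_wpM2r ?powR_ge0//.
apply: (HM _ M1); exists (`|x|^-1 *: x) => //.
by rewrite /S/= normrZ normfV normr_id mulVf.
Qed.

End BigO.

(** * Differentiability at the origin and Lipschitz bounds *)

Lemma open_neq0 (R : realType) n (f : 'rV[R]_n -> R) :
  class_C 0 setT f -> open [set x | f x != 0].
Proof.
move=> /class_C0 cf.
rewrite (_ : [set x | _] = f @^-1` [set~ 0]); last first.
  by apply/seteqP; split => x /= /eqP.
apply: open_comp; first by move=> x _; exact: cf.
by apply: closed_openC; exact: closed_eq.
Qed.

Lemma open_Rd_star (R : realType) d : open (@Rd_star R d).
Proof.
rewrite (_ : @Rd_star R d = [set x | \prod_j x ord0 j != 0]); last first.
  apply/seteqP; split => x /= H; first by apply/prodf_neq0 => j _; exact: H.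
  by move=> j; have /prodf_neq0/(_ j isT) := H.
apply: open_neq0; apply: class_C_prod; first exact: openT.
by move=> j _; exact: class_C_coord.
Qed.

Lemma open_Rd_nonzero (R : realType) d : open (@Rd_nonzero R d).
Proof.
rewrite (_ : @Rd_nonzero R d = [set x | \sum_j x ord0 j ^+ 2 != 0]); last first.
  apply/seteqP; split => x /=.
    apply: contra_neq => /eqP; rewrite psumr_eq0 => [|j _]; last exact: sqr_ge0.
    move=> /allP H; apply/rowP => j; rewrite mxE; apply/eqP.
    by rewrite -sqrf_eq0; apply: H; rewrite mem_index_enum.
  apply: contra_neq => ->; apply: big1 => j _; by rewrite mxE expr0n.
apply: open_neq0; apply: class_C_sum; first exact: openT.
by move=> j _; apply: class_CX; [exact: openT|exact: class_C_coord].
Qed.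

Lemma powR_small (R : realType) (C e a : R) : 0 <= C -> 0 < e -> 0 < a ->
  exists2 r : R, 0 < r & forall t, 0 <= t -> t < r -> C * t `^ e <= a.
Proof.
move=> C0 e0 a0; have C10 : 0 < C + 1 by rewrite ltr_wpDl.
exists ((a / (C + 1)) `^ e^-1); first by rewrite powR_gt0// divr_gt0.
move=> t t0 tr; apply: (@le_trans _ _ ((C + 1) * t `^ e)).
  by rewrite ler_wpM2r ?powR_ge0// lerDl.
rewrite mulrC -ler_pdivlMr//.
have := gt0_ltr_powR e0 _ _ tr; rewrite -powRrM mulVf ?gt_eqF// powRr1; last first.
  by rewrite divr_ge0// ltW.
by move=> H1; apply/ltW/H1; rewrite ?nnegrE ?powR_ge0.
Qed.

(** The bound on [f] makes its differential at 0 vanish, and the bound on the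
    derivatives makes them tend to this value. *)
Lemma class_C1_at0 (R : realType) d (f : 'rV[R]_d -> R) (e : R) : 0 < e ->
  class_C 1 (@Rd_nonzero R d) f -> f 0 = 0 -> Opow (1 + e) f ->
  (forall v, Opow e ('D_v f)) -> class_C 1 setT f.
Proof.
move=> e0 /class_CS[df cdf] f0 Of ODf.
have d0 : is_diff 0 f 0.
  apply: (@is_diff_littleo R 'rV[R]_d R f \0%R); first exact: cst_continuous.
  move=> a a0; have [C [r [C0 r0 H]]] := Of.
  have [q q0 Hq] := powR_small C0 e0 a0.
  exists (Num.min r q); first by rewrite lt_min r0.
  move=> h; rewrite lt_min => /andP[hr hq]; rewrite addr0 f0 subr0 /= subr0.
  have [->|h0] := eqVneq h 0; first by rewrite f0 !normr0 mulr0.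
  rewrite (le_trans (H h h0 hr))// powRD; last by rewrite normr_eq0 h0 implybT.
  by rewrite powRr1// mulrCA mulrC ler_wpM2r// Hq.
apply/class_CS; split => [x _|v].
  by have [->|x0] := eqVneq x 0; [exact: ex_diff|exact: df].
apply/class_C0 => x _; have [->|x0] := eqVneq x 0; last first.
  by move/class_C0 : (cdf v); apply.
have [C [r [C0 r0 H]]] := ODf v.
have D0 : 'D_v f 0 = 0 by rewrite deriveE// diff_val.
apply/continuous_normP => a a0.
have [q q0 Hq] := powR_small C0 e0 a0.
exists (Num.min r q); first by rewrite lt_min r0.
move=> h; rewrite sub0r normrN lt_min => /andP[hr hq]; rewrite D0 sub0r normrN.
have [->|h0] := eqVneq h 0; first by rewrite D0 normr0 ltW.
by rewrite (le_trans (H h h0 hr))// Hq.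
Qed.

Lemma derive_pos_homog_Opow (R : realType) d (b : R) (f : 'rV[R]_d -> R) v :
  pos_homog b f -> class_C 1 (@Rd_nonzero R d) f -> Opow (b - 1) ('D_v f).
Proof.
move=> hf /class_CS[df cdf]; apply: pos_homog_Opow; last exact: cdf.
move=> x t t0 x0; apply: derive_pos_homog => //; apply: df => //.
by rewrite /Rd_nonzero/= scaler_eq0 negb_or x0 gt_eqF.
Qed.

(** The derivatives are homogeneous of degree [b - 1 > 0], hence tend to 0. *)
Lemma pos_homog_class_C1 (R : realType) d (b : R) (f : 'rV[R]_d -> R) :
  1 < b -> pos_homog b f -> class_C 1 (@Rd_nonzero R d) f -> class_C 1 setT f.
Proof.
move=> b1 hf Cf.
have f0 : f 0 = 0 by apply: pos_homog0 hf; exact: lt_trans ltr01 b1.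
apply: (@class_C1_at0 _ _ _ (b - 1)) => //; rewrite ?subr_gt0//.
  rewrite addrC subrK; apply: pos_homog_Opow; last exact: class_C_S.
  by move=> x t t0 _; exact: hf.
by move=> v; exact: derive_pos_homog_Opow.
Qed.

(** The partial derivatives are bounded on some ball around [x]; balls are convex,
    so the mean value theorem applies on the segment between two of its points. *)
Lemma class_C1_locally_lipschitz (R : realType) d (F : 'rV[R]_d -> 'rV[R]_d) :
  (forall i, class_C 1 setT (fun x => F x ord0 i : R)) -> locally_lipschitz F.
Proof.
move=> CF x.
have [r r0 [C C0 HC]] : exists2 r : R, 0 < r & exists2 C : R, 0 <= C &
    forall y i j, `|x - y| < r -> `|'D_(delta_mx ord0 j) (fun x => F x ord0 i : R) y| <= C.
  have H (ij : 'I_d * 'I_d) : exists r : R, 0 < r /\ forall y, `|x - y| < r ->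
      `|'D_(delta_mx ord0 ij.2) (fun x => F x ord0 ij.1 : R) y| <=
      `|'D_(delta_mx ord0 ij.2) (fun x => F x ord0 ij.1 : R) x| + 1.
    have /class_CS[_ /(_ (delta_mx ord0 ij.2))/class_C0/(_ x I)] := CF ij.1.
    move=> /continuous_normP/(_ 1 ltr01)[r r0 Hr].
    exists r; split => // y xy; have := Hr y xy; rewrite distrC => yx.
    set a := 'D_ _ _ y; set b := 'D_ _ _ x.
    by rewrite -[a](subrK b) addrC (le_trans (ler_normD _ _))// lerD2l.
  have /choice[r Hr] := H.
  exists (\big[Num.min/1]_ij r ij).
    by apply: lt_bigmin => // ij _; have [] := Hr ij.
  exists (\sum_ij (`|'D_(delta_mx ord0 ij.2) (fun x => F x ord0 ij.1 : R) x| + 1)).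
    by apply: sumr_ge0 => ij _; exact: addr_ge0.
  move=> y i j xy; have [_ /(_ y)] := Hr (i, j).
  rewrite (lt_le_trans xy); last exact: bigmin_le.
  move=> /(_ isT)/le_trans; apply.
  by rewrite (bigD1 (i, j))//= lerDl sumr_ge0// => ij _; exact: addr_ge0.
exists [set y | `|x - y| < r].
  exact: nbhs_norm_lt.
exists (C * d%:R + 1); split; first by rewrite realE; apply/orP; left; rewrite addr_ge0// mulr_ge0.
move=> K CK [y z] [/= xy xz].
have Cd0 : 0 <= C * d%:R by rewrite mulr_ge0.
have K0 : 0 <= K by rewrite (le_trans _ (ltW CK))// addr_ge0.
rewrite {1}/Num.norm /= mx_normrE; apply: bigmax_le; first by rewrite mulr_ge0.
move=> [i0 i] _ /=; rewrite ord1 {i0} !mxE.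
pose f x := F x ord0 i : R.
have /class_CS[df cdf] := CF i.
pose v := y - z.
have line (t : R) : is_derive t 1 (fun t => f (t *: v + z)) ('D_v f (t *: v + z)).
  by apply: is_derive_line; apply: diff_derivable; exact: df.
have cline : {within `[(0 : R), 1], continuous (fun t : R => f (t *: v + z))}.
  apply: derivable_within_continuous => t _.
  exact: (@ex_derive _ _ _ _ _ _ _ (line t)).
have [c] := @MVT R _ _ 0 1 ltr01 (fun t _ => line t) cline.
rewrite in_itv/= => /andP[c0 c1].
rewrite scale1r subrK scale0r add0r subr0 mulr1 => ->.
rewrite derive_coord; last exact: df.
have yzr : `|x - (c *: v + z)| < r.
  have -> : x - (c *: v + z) = c *: (x - y) + (1 - c) *: (x - z).
    by apply/rowP => k; rewrite !mxE; ring.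
  rewrite (le_lt_trans (ler_normD _ _))// !normrZ (gtr0_norm c0) gtr0_norm ?subr_gt0//.
  have -> : r = c * r + (1 - c) * r by ring.
  by rewrite ltrD// ltr_pM2l// subr_gt0.
rewrite (le_trans (ler_norm_sum _ _ _))//.
apply: (@le_trans _ _ (\sum_(j < d) `|v| * C)).
  apply: ler_sum => j _; rewrite normrM ler_pM//; last exact: HC.
  by rewrite {2}/Num.norm /= mx_normrE; exact: (le_bigmax _ _ (ord0, j)).
rewrite sumr_const card_ord -mulr_natr -mulrA mulrC ler_wpM2r//.
by rewrite (le_trans _ (ltW CK))// lerDl.
Qed.

(** * Powers of norms *)

(** Where [f] vanishes, continuity of the power needs [0 < a] and [0 <= f]: the
    power [powR] of a negative number is 1. *)
Lemma class_C0_powR (R : realType) n (V : set 'rV[R]_n) (f : 'rV[R]_n -> R) (a : R) :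
  0 < a -> (forall x, 0 <= f x) -> class_C 0 V f ->
  class_C 0 V (fun x => f x `^ a).
Proof.
move=> a0 f0 /class_C0 cf; apply/class_C0 => x Vx.
have := f0 x; rewrite le_eqVlt => /orP[/eqP fx0|fx0]; last first.
  apply: (@continuous_comp _ _ _ f (fun r : R => r `^ a)); first exact: cf.
  apply/differentiable_continuous/derivable1_diffP.
  by apply: derivable_powR; rewrite in_itv/= fx0.
apply/continuous_normP => e e0.
have [q q0 Hq] := powR_small ler01 a0 e0.
have q20 : 0 < q / 2 by rewrite divr_gt0.
have [r r0 Hr] := (continuous_normP _ _).1 (cf x Vx) _ q20.
exists r => // y xy; rewrite -fx0 powR0 ?gt_eqF// sub0r normrN.
rewrite ger0_norm ?powR_ge0// -[_ `^ _]mul1r; apply: Hq => //.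
have := Hr y xy; rewrite -fx0 sub0r normrN ger0_norm// => /le_lt_trans; apply.
by rewrite ltr_pdivrMr// ltr_pMr// ltr1n.
Qed.

Section Lpnorm.
Variables (R : realType) (d : nat).
Implicit Types (x : 'rV[R]_d) (p s : R) (V : set 'rV[R]_d).

Lemma lpnorm_ge0 p x : 0 <= lpnorm p x.
Proof. exact: powR_ge0. Qed.

Lemma sum_powR_gt0 p x : x != 0 -> 0 < \sum_(j < d) `|x ord0 j| `^ p.
Proof.
move=> x0; have [j xj] : exists j, x ord0 j != 0.
  apply/existsP; rewrite -negb_forall; apply: contra x0 => /forallP H.
  by apply/eqP/rowP => j; rewrite mxE; apply/eqP.
by rewrite (bigD1 j)//= ltr_pwDl ?powR_gt0 ?normr_gt0// sumr_ge0.
Qed.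

Lemma lpnormZ p x (t : R) : 0 < p -> 0 <= t -> lpnorm p (t *: x) = t * lpnorm p x.
Proof.
move=> p0 t0; rewrite /lpnorm.
under eq_bigr do rewrite mxE normrM (ger0_norm t0) powRM//.
rewrite -mulr_sumr powRM ?powR_ge0 ?sumr_ge0//.
by rewrite -powRrM divff ?gt_eqF// powRr1.
Qed.

Lemma lpnorm_pos_homog p s : 0 < p ->
  pos_homog s (fun x => lpnorm p x `^ s).
Proof. by move=> p0 x t t0; rewrite lpnormZ ?ltW// powRM ?lpnorm_ge0// ltW. Qed.

Lemma lpnorm_le p x : 0 < p -> lpnorm p x <= d%:R `^ p^-1 * `|x|.
Proof.
move=> p0; have -> : d%:R `^ p^-1 * `|x| = (d%:R * `|x| `^ p) `^ p^-1.
  by rewrite powRM ?powR_ge0// -powRrM divff ?gt_eqF// powRr1.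
apply: ge0_ler_powR; rewrite ?nnegrE ?invr_ge0 ?(ltW p0) ?mulr_ge0 ?powR_ge0//.
  exact: sumr_ge0.
rewrite mulr_natl -[X in _ *+ X]card_ord -sumr_const; apply: ler_sum => j _.
apply: ge0_ler_powR; rewrite ?nnegrE ?(ltW p0)//.
by rewrite [leRHS]/Num.norm /= mx_normrE; exact: (le_bigmax _ _ (ord0, j)).
Qed.

Lemma lpnorm_ge p x : 0 < p -> `|x| <= lpnorm p x.
Proof.
move=> p0; rewrite {1}/Num.norm /= mx_normrE; apply: bigmax_le => [|[i j] _].
  exact: lpnorm_ge0.
rewrite ord1 /= -[leLHS]powRr1// -(divff (lt0r_neq0 p0)) powRrM.
apply: ge0_ler_powR; rewrite ?nnegrE ?invr_ge0 ?(ltW p0) ?powR_ge0//.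
  exact: sumr_ge0.
by rewrite (bigD1 j)//= lerDl sumr_ge0.
Qed.

Lemma class_C_lpnorm V p s k : open V -> V `<=` @Rd_nonzero R d ->
  (forall j, class_C k V (fun x => `|x ord0 j| `^ p : R)) ->
  class_C k V (fun x => lpnorm p x `^ s).
Proof.
move=> oV V0 Cp; apply: class_C_powR => // [x /V0 x0|].
  by rewrite powR_gt0// sum_powR_gt0.
apply: class_C_powR => // [x /V0 x0|]; first exact: sum_powR_gt0.
exact: class_C_sum.
Qed.

Lemma class_C0_lpnorm p s : 0 < p -> 0 < s ->
  class_C 0 setT (fun x => lpnorm p x `^ s).
Proof.
move=> p0 s0; apply: class_C0_powR => //; first exact: lpnorm_ge0.
apply: class_C0_powR; rewrite ?invr_gt0//; first by move=> x; exact: sumr_ge0.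
apply: class_C_sum; first exact: openT.
move=> j _; apply: class_C0_powR => //.
apply/class_C0 => x _.
apply: (@continuous_comp _ _ _ (fun x : 'rV[R]_d => x ord0 j : R) (fun r : R => `|r|)).
  by move/class_C0 : (@class_C_coord R d setT j 0); apply.
exact: norm_continuous.
Qed.

Lemma class_C_abs_powR_neq0 V p j k : open V ->
  (forall x, V x -> x ord0 j != 0) ->
  class_C k V (fun x => `|x ord0 j| `^ p : R).
Proof.
move=> oV V0.
(* |t|^p = (t^2)^(p/2), a power of a smooth positive function. *)
rewrite (_ : (fun _ => _) = fun x => (x ord0 j ^+ 2) `^ (p / 2)).
  apply: class_C_powR => // [x /V0 xj|]; first by rewrite exprn_even_gt0.
  by apply: class_CX => //; exact: class_C_coord.
apply/funext => x; rewrite -real_normK ?num_real// -powR_mulrn// -powRrM.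
by rewrite mulrC divfK// pnatr_eq0.
Qed.

Lemma class_C_abs_powR_even V j (a : nat) k : open V ->
  class_C k V (fun x => `|x ord0 j| `^ (2 * a)%:R : R).
Proof.
move=> oV.
rewrite (_ : (fun _ => _) = fun x => x ord0 j ^+ (2 * a)).
  by apply: class_CX => //; exact: class_C_coord.
by apply/funext => x; rewrite powR_mulrn// !exprM real_normK ?num_real.
Qed.

End Lpnorm.

(** On the line, [|t|^p] is homogeneous of degree [p > 1] and smooth away from 0,
    so [pos_homog_class_C1] applies in dimension 1. *)
Lemma class_C1_abs_powR (R : realType) d (p : R) (j : 'I_d) : 1 < p ->
  class_C 1 setT (fun x : 'rV[R]_d => `|x ord0 j| `^ p : R).
Proof.
move=> p1.
pose f (z : 'rV[R]_1) : R := `|z ord0 ord0| `^ p.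
have Cf : class_C 1 setT f.
  apply: (@pos_homog_class_C1 _ _ p) => //.
    by move=> z t t0; rewrite /f mxE normrM powRM// gtr0_norm.
  apply: class_C_abs_powR_neq0; first exact: open_Rd_nonzero.
  move=> z; apply: contra_neq => z0; apply/rowP => i; rewrite ord1 mxE.
  exact: z0.
rewrite (_ : (fun _ => _) = f \o (fun x : 'rV[R]_d => \row_(i < 1) x ord0 j)).
  apply: (@class_C_comp _ _ _ _ setT) => //; first exact: openT.
  move=> i; rewrite (_ : (fun _ => _) = fun x : 'rV[R]_d => x ord0 j : R).
    exact: class_C_coord.
  by apply/funext => x; rewrite mxE.
by apply/funext => x; rewrite /f /= mxE.
Qed.

(** * Homogeneous polynomials *)

Section Meval.
Variables (R : realType) (d : nat) (P : mpoly d R).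

Lemma class_C_meval V k : open V ->
  class_C k V (fun x : 'rV[R]_d => meval (fun j => x ord0 j) P : R).
Proof.
move=> oV; rewrite (_ : (fun _ => _) = fun x : 'rV[R]_d =>
  \sum_(m <- msupp P) mcoeff m P * \prod_i x ord0 i ^+ fun_of_multinom m i).
  apply: class_C_sum => // m _; apply: class_CM => //; first exact: class_C_cst.
  apply: class_C_prod => // i _; apply: class_CX => //; exact: class_C_coord.
by apply/funext => x; rewrite mevalE.
Qed.

Lemma meval_pos_homog m0 : P \is ishomog1 m0 mdeg ->
  pos_homog m0%:R (fun x : 'rV[R]_d => meval (fun j => x ord0 j) P : R).
Proof.
move=> /dhomogP homP x t t0; rewrite powR_mulrn ?ltW// !mevalE mulr_sumr.
apply: eq_big_seq => m /homP <-; rewrite mulrCA; congr (_ * _).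
transitivity (t ^+ (\sum_i fun_of_multinom m i) *
  \prod_i x ord0 i ^+ fun_of_multinom m i); last by rewrite -mdegE.
rewrite expr_sum -big_split /=; apply: eq_bigr => i _.
by rewrite mxE exprMn.
Qed.

End Meval.

(** * Superpositions of homogeneous functions *)

(** The Euclidean norm and the max norm are equivalent; the point 0, excluded in
    [Opow], is covered by [f 0 = 0]. *)
Lemma bigO_at0_coord (R : realType) d (b : R) (f : 'rV[R]_d -> 'rV[R]_d) :
  0 <= b -> f 0 = 0 -> (forall i, Opow b (fun x => f x ord0 i)) ->
  bigO_at0 f (fun x => enorm x `^ b).
Proof.
move=> b0 f0 /Opow_row[C [r [C0 r0 H]]].
have t2 : 0 < 2 :> R by [].
exists r, (d%:R `^ 2^-1 * C + 1); split => //.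
  by rewrite ltr_wpDl// mulr_ge0 ?powR_ge0.
move=> x xr; have nx : `|x| <= enorm x := lpnorm_ge x t2.
have ex0 : 0 <= enorm x := lpnorm_ge0 2 x.
have [x0|x0] := eqVneq x 0.
  rewrite x0 f0 /enorm -(scale0r (0 : 'rV[R]_d)) lpnormZ// mul0r.
  by rewrite mulr_ge0 ?powR_ge0// addr_ge0 ?mulr_ge0 ?powR_ge0.
apply: (le_trans (lpnorm_le _ t2)).
apply: (@le_trans _ _ (d%:R `^ 2^-1 * C * enorm x `^ b)); last first.
  by rewrite ler_wpM2r ?powR_ge0// lerDl.
rewrite -mulrA ler_wpM2l ?powR_ge0// (le_trans (H x x0 (le_lt_trans nx xr)))//.
by rewrite ler_wpM2l// ge0_ler_powR// nnegrE.
Qed.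

(** What matters about the powers of norms is that they are the nonnegative
    continuous coordinates [Y x ord0 j], positively homogeneous of degree [s j]. The
    factor [g] is a smooth map homogeneous of degree [q]. *)
Section Superposition.
Variables (R : realType) (d m : nat) (delta : R) (G : 'rV[R]_m -> R).
Hypothesis delta0 : 0 < delta.
Hypothesis G_smooth : class_Coo [set y : 'rV[R]_m | forall j, - delta < y ord0 j] G.
Hypothesis G_at0 : G 0 = 0.
Variables (s : 'I_m -> R) (sbar : R).
Hypothesis sbar0 : 0 < sbar.
Hypothesis sbar_min : forall j, sbar <= s j.
Variable Y : 'rV[R]_d -> 'rV[R]_m.
Hypothesis Y_ge0 : forall x j, 0 <= Y x ord0 j.
Hypothesis Y_homog : forall j, pos_homog (s j) (fun x => Y x ord0 j).
Hypothesis Y_cont : forall j, class_C 0 setT (fun x => Y x ord0 j : R).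
Variables (q : R) (g : 'rV[R]_d -> 'rV[R]_d).
Hypothesis q0 : 0 <= q.
Hypothesis g_homog : forall i, pos_homog q (fun x => g x ord0 i).
Hypothesis g_smooth : forall i k, class_C k setT (fun x => g x ord0 i : R).
Hypothesis sq1 : 1 < sbar + q.

Let F x := G (Y x) *: g x.

Let s0 j : 0 < s j.
Proof. exact: lt_le_trans sbar0 (sbar_min j). Qed.

Let Y0 : Y 0 = 0.
Proof. by apply/rowP => j; rewrite mxE; exact: pos_homog0 (Y_homog j). Qed.

Let Opow_Ys j : Opow (s j) (fun x => Y x ord0 j).
Proof.
apply: pos_homog_Opow; first by move=> x t t0 _; exact: Y_homog.
exact: (class_C_sub (@subsetT _ _) (@Y_cont j)).
Qed.

Let Opow_Y j : Opow sbar (fun x => Y x ord0 j).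
Proof. exact: Opow_le (Opow_Ys j). Qed.

Let Opow_g i : Opow q (fun x => g x ord0 i).
Proof.
apply: pos_homog_Opow; first by move=> x t t0 _; exact: g_homog.
exact: (class_C_sub (@subsetT _ _) (g_smooth i 0)).
Qed.

Let G_ball k : class_C k [set y | `|y| < delta] G.
Proof.
apply: class_C_sub (G_smooth k) => y /= yd j; rewrite ltrNl.
apply: le_lt_trans yd; rewrite (le_trans (ler_norm _))// normrN.
by rewrite [leRHS]/Num.norm /= mx_normrE; exact: (le_bigmax _ _ (ord0, j)).
Qed.

Let Y_box x j : - delta < Y x ord0 j.
Proof. by rewrite (lt_le_trans _ (Y_ge0 x j))// oppr_lt0. Qed.

Lemma superposition0 : F 0 = 0.
Proof. by rewrite /F Y0 G_at0 scale0r. Qed.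

Lemma class_C_superposition_coord V k i : open V ->
  (forall j, class_C k V (fun x => Y x ord0 j : R)) ->
  class_C k V (fun x => F x ord0 i : R).
Proof.
move=> oV CY.
rewrite (_ : (fun _ => _) = (G \o Y) * (fun x => g x ord0 i)).
  apply: class_CM => //; last by apply: class_C_sub (g_smooth i k).
  by apply: class_C_comp (G_smooth k) => // x _ j; exact: Y_box.
by apply/funext => x; rewrite /F !mxE.
Qed.

Let Opow_taylor n : Opow (sbar * n%:R)
  (fun x => G (Y x) - \sum_(k < n) taylor_part k G (Y x) / k`!%:R).
Proof.
have [C [r [r0 _ H]]] := taylor_bound delta0 (G_ball n).
exact: (@Opow_comp _ _ _ _ _ Y (fun y => G y - \sum_(k < n) taylor_part k G y / k`!%:R) _ _ _ r0 H).
Qed.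

Let Opow_G : Opow sbar (G \o Y).
Proof.
rewrite -[sbar]mulr1; apply: Opow_ext (Opow_taylor 1) => x _ /=.
by rewrite big_ord1 taylor_part0 G_at0 mul0r subr0.
Qed.

Let Opow_dG j : Opow 0 (('D_(delta_mx ord0 j) G : 'rV[R]_m -> R) \o Y).
Proof.
have [_ /(_ (delta_mx ord0 j)) CG] := (class_CS _ _ _).1 (G_ball 1).
have [C [r [r0 _ H]]] := taylor_bound delta0 CG.
rewrite -(mulr0 sbar); apply: (@Opow_comp _ _ _ _ 0 _ _ C r) => // y yr.
by have := H y yr; rewrite big_ord0 subr0.
Qed.

(** The coordinates of [G(Y) g] are [O(|x|^(sbar + q))]. By the product and chain rules
    their derivatives are sums of products of homogeneous functions with either
    [D_j G (Y x)], which is bounded, or [G (Y x)], which is [O(|x|^sbar)]; every such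
    product is [O(|x|^(sbar + q - 1))], and [sbar + q > 1]. *)
Lemma superposition_C1 :
  (forall j, class_C 1 (@Rd_nonzero R d) (fun x => Y x ord0 j : R)) ->
  forall i, class_C 1 setT (fun x => F x ord0 i : R).
Proof.
move=> CY i.
have CF := class_C_superposition_coord i (@open_Rd_nonzero R d) CY.
have e0 : 0 < sbar + q - 1 by rewrite subr_gt0.
have Fi : (fun x => F x ord0 i) = (fun x => (G \o Y) x * g x ord0 i).
  by apply/funext => x; rewrite /F !mxE.
apply: (class_C1_at0 e0 CF).
- by rewrite superposition0 mxE.
- by rewrite addrC subrK Fi; exact: OpowM.
move=> v.
have dY x : x != 0 -> differentiable Y x.
  by move=> x0; have [dY _] := (class_CS _ _ _).1 (class_C_row (@open_Rd_nonzero R d) CY); exact: dY.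
have dG x : differentiable G (Y x).
  have [dG _] := (class_CS _ _ _).1 (G_smooth 1); apply: dG => j; exact: Y_box.
have dg x : differentiable (fun x => g x ord0 i : R) x.
  by have [dg _] := (class_CS _ _ _).1 (g_smooth i 1); exact: dg.
suff : Opow (sbar + q - 1) (fun x =>
    (G \o Y) x * 'D_v (fun x => g x ord0 i : R) x +
    \sum_j ('D_v (fun x => Y x ord0 j : R) x *
      (('D_(delta_mx ord0 j) G : 'rV[R]_m -> R) \o Y) x) * g x ord0 i).
  apply: Opow_ext => x x0; rewrite Fi.
  have -> : (fun x => (G \o Y) x * g x ord0 i) = (G \o Y) * (fun x => g x ord0 i : R) by [].
  rewrite deriveM; last 2 first.
    by apply: diff_derivable; apply: differentiable_comp => //; exact: dY.
    exact: diff_derivable.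
  rewrite derive_comp_row//; last exact: dY.
  rewrite /GRing.scale /=; congr (_ + _); rewrite mulr_sumr.
  by apply: eq_bigr => j _; rewrite [RHS]mulrC.
apply: OpowD.
  rewrite -addrA; apply: OpowM => //.
  have Cg := class_C_sub (@subsetT _ (@Rd_nonzero R d)) (g_smooth i 1).
  exact: (derive_pos_homog_Opow v (@g_homog i) Cg).
apply: Opow_sum => j _.
apply: (@Opow_le _ _ _ (s j - 1 + 0 + q)).
  by rewrite addr0 addrAC lerD2r lerD2r.
apply: OpowM => //; apply: OpowM => //.
exact: (derive_pos_homog_Opow v (@Y_homog j) (CY j)).
Qed.


(** The degree of homogeneity of the term of the expansion indexed by [w]. *)
Let degree w : R := q + \sum_(j <- w) s j.

Let degree_ge w : q + sbar * (size w)%:R <= degree w.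
Proof.
rewrite lerD2l mulr_natr; elim: w => [|j w IHw]; first by rewrite big_nil mulr0n.
by rewrite big_cons mulrS lerD.
Qed.

(** A word of degree at most [B] has at most [max_size B] letters, since each
    letter contributes at least [sbar]. *)
Let max_size (B : R) : nat := Num.trunc (B / sbar).

Let degree_gt B i w : (max_size B < i)%N -> w \in words m i -> B < degree w.
Proof.
move=> Bi /size_words wi; apply: lt_le_trans (degree_ge w).
rewrite wi ltr_wpDl// mulrC -ltr_pdivrMr//.
by apply: lt_le_trans (truncnS_gt _) _; rewrite ler_nat.
Qed.

Let degrees : set R := [set v | exists2 w, w != [::] & v = degree w].

Let degrees_enumeration j0 : s j0 = sbar -> exists beta : nat -> R,
  [/\ beta 0%N = sbar + q, forall k, degrees (beta k),
      {homo beta : k l / (k < l)%N >-> k < l},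
      forall v, degrees v -> exists k, v = beta k &
      beta k @[k --> \oo] --> +oo].
Proof.
move=> sj0; apply: discrete_enumeration.
- by exists [:: j0] => //; rewrite /degree big_seq1 sj0 addrC.
- move=> _ [w w0 ->]; apply: le_trans (degree_ge w).
  by rewrite addrC lerD2l ler_peMr ?(ltW sbar0)// ler1n lt0n size_eq0.
- move=> _ [w w0 ->]; exists (degree (j0 :: w)); first by exists (j0 :: w).
  by rewrite /degree big_cons ltrD2l ltrDr.
move=> B; exists [seq degree w | i <- iota 0 (max_size B).+1, w <- words m i].
move=> _ [w w0 ->] wB; apply/allpairsPdep; exists (size w), w; split => //.
  rewrite mem_iota /= add0n ltnS leqNgt; apply/negP => /degree_gt/(_ (mem_words w)).
  by rewrite ltNge wB.
exact: mem_words.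
Qed.

Let coef k w : R := taylor_coef w G / k`!%:R.

(** The sum of all Taylor terms of degree [b], finite by [degree_gt]. *)
Let part (b : R) (x : 'rV[R]_d) : R :=
  \sum_(i < (max_size b).+1) \sum_(w <- words m i)
    coef i w * (degree w == b)%:R * monom w (Y x).

Let part_widen n b x : (max_size b <= n)%N ->
  part b x = \sum_(i < n.+1) \sum_(w <- words m i)
    coef i w * (degree w == b)%:R * monom w (Y x).
Proof.
move=> bn; rewrite /part.
rewrite (big_ord_widen n.+1 (fun i => \sum_(w <- words m i)
    coef i w * (degree w == b)%:R * monom w (Y x)))//.
rewrite big_mkcond /=; apply: eq_bigr => i _.
case: ltnP => // bi; rewrite big1_seq// => w /andP[_ /(degree_gt bi) bw].
by rewrite gt_eqF// mulr0 mul0r.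
Qed.

Let part_homog b x (t : R) : 0 < t ->
  part b (t *: x) *: g (t *: x) = t `^ b *: (part b x *: g x).
Proof.
move=> t0; have -> : g (t *: x) = t `^ q *: g x.
  by apply/rowP => i; rewrite mxE; exact: g_homog.
rewrite !scalerA; congr (_ *: _).
rewrite mulr_suml mulr_sumr; apply: eq_bigr => i _.
rewrite mulr_suml mulr_sumr; apply: eq_bigr => w _.
have [wb|] := eqVneq (degree w) b; last by rewrite mulr0 !mul0r mulr0.
have -> : t `^ b = t `^ degree w by rewrite wb.
rewrite mulr1.
have -> : monom w (Y (t *: x)) = t `^ (\sum_(j <- w) s j) * monom w (Y x).
  rewrite /monom; elim: (w) => [|j w' IHw].
    by rewrite !big_nil powRr0 mulr1.
  rewrite !big_cons IHw Y_homog// powRD; last by rewrite (gt_eqF t0) implybT.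
  by rewrite mulrACA.
rewrite /degree powRD; last by rewrite (gt_eqF t0) implybT.
by ring.
Qed.

Let part_smooth V k b : open V ->
  (forall j, class_C k V (fun x => Y x ord0 j : R)) ->
  class_C k V (fun x => part b x *: g x).
Proof.
move=> oV CY; apply: class_C_row => // i.
rewrite (_ : (fun _ => _) = part b * (fun x => g x ord0 i : R)); last first.
  by apply/funext => x; rewrite mxE.
apply: class_CM => //; last exact: (class_C_sub (@subsetT _ _) (g_smooth i k)).
apply: class_C_sum => // l _; apply: class_C_sum => // w _.
rewrite (_ : (fun _ => _) = cst (coef l w * (degree w == b)%:R) *
    (fun x => \prod_(j <- w) Y x ord0 j))//.
apply: class_CM => //; first exact: class_C_cst.
exact: class_C_prod.
Qed.

(** The terms are the [part (b k) x *: g x], where [b] enumerates the degrees of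
    the nonempty words; the empty word contributes [G 0 = 0]. To compare [F] with the
    first [N + 1] terms, use the Taylor polynomial of an order [n] so large that its
    remainder is [O(|x|^(b (N + 1)))]: a word of length at most [n] either has a degree
    among [b 0, ..., b N], and cancels, or has degree at least [b (N + 1)]. *)
Lemma superposition_expansion V : open V -> (exists j, s j = sbar) ->
  (forall j, class_Coo V (fun x => Y x ord0 j : R)) ->
  infinite_expansion V F.
Proof.
move=> oV [j0 sj0] CY.
have [b [b0 bD b_lt bsurj b_oo]] := degrees_enumeration sj0.
have b_le k l : (k <= l)%N -> b k <= b l.
  by rewrite leq_eqVlt => /orP[/eqP ->//|/b_lt/ltW].
have b1 k : 1 < b k by apply: (lt_le_trans sq1); rewrite -b0 b_le.
exists b, (fun k x => part (b k) x *: g x); split => //.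
  move=> k; split; first by move=> x t; exact: part_homog.
  by move=> l; apply: part_smooth => // j; exact: CY.
move=> N; exists (b N.+1); first exact: b_lt.
apply: bigO_at0_coord.
- by rewrite (le_trans ler01)// ltW.
- rewrite superposition0 sub0r big1 ?oppr0// => k _; apply/rowP => i.
  rewrite [RHS]mxE; apply: (@pos_homog0 _ _ (b k)
    (fun x => (part (b k) x *: g x) ord0 i)); first exact: lt_trans ltr01 (b1 k).
  by move=> x t t0; rewrite part_homog// mxE.
move=> i; pose n := max_size (b N.+1).
have bn k : (k <= N.+1)%N -> (max_size (b k) <= n)%N.
  by move=> kN; apply: le_truncn; rewrite ler_pM2r ?invr_gt0// b_le.
(* The coefficient left on w after subtracting the first N + 1 terms. *)
pose c l w : R := coef l w * (1 - \sum_(k < N.+1) (degree w == b k)%:R).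
suff : Opow (b N.+1) (fun x =>
    (G (Y x) - \sum_(l < n.+1) taylor_part l G (Y x) / l`!%:R) * g x ord0 i +
    \sum_(l < n.+1) \sum_(w <- words m l) c l w * (monom w (Y x) * g x ord0 i)).
  apply: Opow_ext => x _; rewrite !mxE summxE.
  rewrite mulrBl -addrA; congr (_ + _).
  rewrite mulr_suml -sumrN -big_split /=.
  under [in RHS]eq_bigr => k _ do rewrite mxE (part_widen x (bn k (ltnW (ltn_ord k)))).
  under [in RHS]eq_bigr do rewrite mulr_suml.
  rewrite exchange_big /= -sumrN; apply: eq_bigr => l _.
  under [in RHS]eq_bigr do rewrite mulr_suml.
  rewrite exchange_big /= /taylor_part !mulr_suml -!sumrN -big_split /=.
  apply: eq_bigr => w _; rewrite -!mulr_suml -mulr_sumr /c /coef.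
  by ring.
apply: OpowD.
  apply: (@Opow_le _ _ _ (sbar * n.+1%:R + q)); last exact: OpowM.
  rewrite ler_wpDr// mulrC -ler_pdivrMr//; apply/ltW; exact: truncnS_gt.
apply: Opow_sum => l _; apply: Opow_sum => w _.
suff [->|bw] : c l w = 0 \/ b N.+1 <= degree w.
- by apply: Opow_ext (Opow0 _ _) => x _; rewrite mul0r.
- apply: (Opow_le bw); rewrite -[degree w]add0r.
  apply: OpowM; first exact: Opow_cst.
  rewrite /degree addrC; apply: OpowM => //.
  exact: Opow_prod.
have [->|w0] := eqVneq w [::].
  by left; rewrite /c /coef /= G_at0 !mul0r.
have [k wk] := bsurj (degree w) (ex_intro2 _ _ w w0 erefl).
have [Nk|kN] := ltnP N k; first by right; rewrite wk b_le.
left; rewrite /c (bigD1 (Ordinal (kN : (k < N.+1)%N)))//= -wk eqxx big1.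
  by rewrite addr0 subrr mulr0.
move=> k' /eqP k'k; rewrite wk; apply/eqP; rewrite pnatr_eq0 eqb0.
apply/negP => /eqP bkk'; apply: k'k; apply/val_inj => /=.
by case: (ltngtP (k' : nat) k) => // /b_lt; rewrite bkk' ltxx.
Qed.

End Superposition.

Theorem theorem6p1 (R : realType) (d m : nat) (hd : (0 < d)%N) (hm : (0 < m)%N)
    (delta : R) (hdelta : 0 < delta)
    (G : 'rV[R]_m -> R)
    (hG : class_Coo [set y : 'rV[R]_m | forall j, - delta < y ord0 j] G)
    (hG0 : G 0 = 0)
    (m0 : nat) (G0 : 'rV[R]_d -> 'rV[R]_d)
    (hG0poly : homogeneous_polynomial_map m0 G0)
    (p s : 'I_m -> R)
    (hp : forall j, 1 <= p j) (hs : forall j, 0 < s j)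
    (F : 'rV[R]_d -> 'rV[R]_d)
    (hF : forall x, F x = G (\row_(j < m) (lpnorm (p j) x `^ s j)) *: G0 x)
    (sbar : R)
    (hsbar : (exists j, s j = sbar) /\ (forall j, sbar <= s j))
    (hsm : 1 < sbar + m0%:R) :
  [/\ [/\ F 0 = 0, continuous F & class_Coo (@Rd_star R d) F],
      X_cont (@Rd_star R d) F,
      (forall j, 1 < p j) -> class_C 1 setT F /\ locally_lipschitz F &
      (forall j, exists k : nat, p j = (2 * k)%:R) ->
        X_lip (@Rd_nonzero R d) F].
Proof.
case: hsbar => sbar_ex sbar_min.
have sbar0 : 0 < sbar by case: sbar_ex => j <-; exact: hs.
have p0 j : 0 < p j by rewrite (lt_le_trans ltr01)// hp.
pose Y (x : 'rV[R]_d) : 'rV[R]_m := \row_(j < m) (lpnorm (p j) x `^ s j).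
have YE j : (fun x => Y x ord0 j) = (fun x => lpnorm (p j) x `^ s j).
  by apply/funext => x; rewrite mxE.
have Y_ge0 x j : 0 <= Y x ord0 j by rewrite mxE powR_ge0.
have Y_homog j : pos_homog (s j) (fun x => Y x ord0 j).
  by rewrite YE; exact: lpnorm_pos_homog.
have Y_cont j : class_C 0 setT (fun x => Y x ord0 j : R).
  by rewrite YE; exact: class_C0_lpnorm.
have Y_smooth V k : open V -> V `<=` @Rd_nonzero R d ->
    (forall j i, class_C k V (fun x => `|x ord0 i| `^ p j : R)) ->
    forall j, class_C k V (fun x => Y x ord0 j : R).
  by move=> oV V0 Ck j; rewrite YE; exact: class_C_lpnorm.
case: hG0poly => P [P_homog G0E].
have G0i i : (fun x => G0 x ord0 i) = (fun x => meval (fun j => x ord0 j) (P i)).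
  by apply/funext => x; exact: G0E.
have G0_homog i : pos_homog m0%:R (fun x => G0 x ord0 i).
  by rewrite G0i; exact: meval_pos_homog.
have G0_smooth i k : class_C k setT (fun x => G0 x ord0 i : R).
  by rewrite G0i; apply: class_C_meval; exact: openT.
have FE : F = fun x => G (Y x) *: G0 x by apply/funext.
have CF V k : open V -> (forall j, class_C k V (fun x => Y x ord0 j : R)) ->
    class_C k V F.
  move=> oV CY; rewrite FE; apply: class_C_row => // i.
  exact: (class_C_superposition_coord hdelta hG).
have expF V : open V -> (forall j, class_Coo V (fun x => Y x ord0 j : R)) ->
    infinite_expansion V F.
  move=> oV CY; rewrite FE.
  exact: (superposition_expansion hdelta hG hG0 sbar0 sbar_min Y_homog Y_cont
    (ler0n R m0) G0_homog G0_smooth hsm).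
have F_cont : continuous F.
  by move=> x; have := CF setT 0%N openT Y_cont; apply.
have star_nonzero : @Rd_star R d `<=` @Rd_nonzero R d.
  move=> x x_star; apply/eqP => x0; have := x_star (Ordinal hd).
  by rewrite x0 mxE eqxx.
have Y_star j : class_Coo (@Rd_star R d) (fun x => Y x ord0 j : R).
  move=> k; apply: Y_smooth => //; first exact: open_Rd_star.
  move=> {}j i; apply: class_C_abs_powR_neq0; first exact: open_Rd_star.
  by move=> x; apply.
have F_lip : (forall j, 1 < p j) -> class_C 1 setT F /\ locally_lipschitz F.
  move=> p1.
  have C1 i : class_C 1 setT (fun x => F x ord0 i : R).
    rewrite FE.
    apply: (@superposition_C1 _ _ _ delta _ hdelta hG hG0 s sbar) => //.
    apply: Y_smooth => //; first exact: open_Rd_nonzero.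
    move=> j l; exact: (class_C_sub (@subsetT _ _) (class_C1_abs_powR l (p1 j))).
  split; last exact: class_C1_locally_lipschitz.
  by apply: class_C_row => //; exact: openT.
split => //.
- split => //.
  + rewrite FE; exact: (superposition0 hG0 sbar0 sbar_min Y_homog).
  + by move=> k; apply: CF; [exact: open_Rd_star|move=> j; exact: Y_star].
- by split => //; left; apply: expF => //; exact: open_Rd_star.
move=> p_even; split.
  apply: (F_lip _).2 => j; have [k pk] := p_even j.
  move: (hp j); rewrite pk -[1]/(1%:R) ler_nat ltr_nat.
  by case: k {pk} => [|k] //; rewrite mulnS.
left; apply: expF; first exact: open_Rd_nonzero.
move=> j k; apply: Y_smooth => //; first exact: open_Rd_nonzero.
move=> {}j i; have [a ->] := p_even j.
by apply: class_C_abs_powR_even; exact: open_Rd_nonzero.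
Qed.
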